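(* Let $\alpha>-1$, $\beta>-1$, $M\ge 0$, $N\ge 0$ be real with $M^2+N^2>0$, and consider the differential equation $$M\sum_{i=0}^{\infty}a_i(x)y^{(i)}(x)+N\sum_{i=0}^{\infty}b_i(x)y^{(i)}(x)+MN\sum_{i=0}^{\infty}c_i(x)y^{(i)}(x)$$ $$+(1-x^2)y''(x)+\left[\beta-\alpha-(\alpha+\beta+2)x\right]y'(x)+n(n+\alpha+\beta+1)y(x)=0$$ with the coefficients $a_i,b_i,c_i$ given in the context (this is the equation satisfied by the generalized Jacobi polynomials $y=P_n^{\alpha,\beta,M,N}$). Then: (1) If $\alpha\notin\{0,1,2,\ldots\}$ and $\beta\notin\{0,1,2,\ldots\}$, the order of this differential equation is infinite. (2) If $M>0$, $N=0$ and $\beta\in\{0,1,2,\ldots\}$, the order equals $2\beta+4$. (3) If $M=0$, $N>0$ and $\alpha\in\{0,1,2,\ldots\}$, the order equals $2\alpha+4$. (4) If $M>0$, $N>0$ and $\alpha,\beta\in\{0,1,2,\ldots\}$, the order equals $2\alpha+2\beta+6$.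
   Context: The order of the differential equation is the largest $i$ for which the total coefficient of $y^{(i)}$ (i.e. $Ma_i(x)+Nb_i(x)+MNc_i(x)$, plus $\beta-\alpha-(\alpha+\beta+2)x$ when $i=1$ and plus $1-x^2$ when $i=2$) is not identically zero as a function of $x$; the order is infinite if there are infinitely many such $i$. Notation: $(a)_0=1$, $(a)_k=a(a+1)\cdots(a+k-1)$ for $k\ge 1$. ${}_pF_q\left(\left.{a_1,\ldots,a_p\atop b_1,\ldots,b_q}\right|z\right)=\sum_{k\ge 0}\frac{(a_1)_k\cdots(a_p)_k}{(b_1)_k\cdots(b_q)_k}\frac{z^k}{k!}$; with a numerator parameter $-\ell$, $\ell\in\{0,1,2,\ldots\}$, it is a finite sum over $0\le k\le\ell$. The coefficients of index $0$ depend on $n$ but not on $x$ and are irrelevant for the order: $a_0=b_0=c_0=0$ for $n=0$; $c_0=0$ for $n=1$; for $n\ge1$, $a_0=(\alpha+\beta+2)\frac{(\beta+3)_{n-1}(\alpha+\beta+3)_{n-1}}{(\alpha+1)_{n-1}(n-1)!}$ and $b_0=(\alpha+\beta+2)\frac{(\alpha+3)_{n-1}(\alpha+\beta+3)_{n-1}}{(\beta+1)_{n-1}(n-1)!}$; for $n\ge 2$, $c_0=\frac{(\alpha+\beta+2)^2(\alpha+\beta+3)}{(\alpha+1)(\beta+1)}\frac{(\alpha+\beta+4)_{n-1}}{(n-1)!}\frac{(\alpha+\beta+4)_{n-2}}{(n-2)!}$. For $i=1,2,3,\ldots$ $$a_i(x)=-(\alpha+\beta+2)2^i\sum_{\ell=0}^{i-1}(-1)^{\ell}\frac{(\beta+3)_{i-\ell-1}(-\beta-2)_{i-\ell-1}}{(\alpha+1)_{i-\ell-1}\,(i-\ell)!\,(i-\ell-1)!\,\ell!}\;{}_3F_2\!\left(\left.{-\ell,\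 \alpha+\beta+3,\ \beta+i-\ell+2\atop \alpha+i-\ell,\ i-\ell+1}\right|1\right)\left(\frac{x+1}{2}\right)^{\ell+1},$$ $$b_i(x)=(\alpha+\beta+2)(-2)^i\sum_{\ell=0}^{i-1}\frac{(\alpha+3)_{i-\ell-1}(-\alpha-2)_{i-\ell-1}}{(\beta+1)_{i-\ell-1}\,(i-\ell)!\,(i-\ell-1)!\,\ell!}\;{}_3F_2\!\left(\left.{-\ell,\ \alpha+\beta+3,\ \alpha+i-\ell+2\atop \beta+i-\ell,\ i-\ell+1}\right|1\right)\left(\frac{x-1}{2}\right)^{\ell+1}.$$ Further $c_1(x)=0$ and for $i=2,3,4,\ldots$, $c_i(x)=c_i^{(1)}(x)+c_i^{(2)}(x)$ with $$c_i^{(1)}(x)=-\frac{(\alpha+\beta+2)^2(\alpha+\beta+3)(\alpha+\beta+4)}{(\alpha+1)(\beta+1)\,i}(x^2-1)2^{i-2}\sum_{\ell=0}^{i-2}(-1)^{\ell}\frac{(\beta+3)_{i-\ell-2}(-\alpha-\beta-3)_{i-\ell-2}}{(i-\ell-1)!\,(i-\ell-2)!\,\ell!\,(i-\ell-1)!}$$ $$\times\;{}_4F_3\!\left(\left.{-\ell,\ \alpha+\beta+5,\ \alpha+\beta+4,\ \beta+i-\ell+1\atop \beta+3,\ i-\ell,\ i-\ell}\right|1\right)\left(\frac{x+1}{2}\right)^{\ell+1},$$ $$c_i^{(2)}(x)=\frac{(\alpha+\beta+2)^2(\alpha+\beta+3)(\alpha+\beta+4)}{(\alpha+1)(\beta+1)\,i}(x^2-1)(-2)^{i-2}\sum_{\ell=0}^{i-2}\frac{(\alpha+3)_{i-\ell-2}(-\alpha-\beta-3)_{i-\ell-2}}{(i-\ell-1)!\,(i-\ell-2)!\,\ell!\,(i-\ell-1)!}$$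 $$\times\;{}_4F_3\!\left(\left.{-\ell,\ \alpha+\beta+5,\ \alpha+\beta+4,\ \alpha+i-\ell+1\atop \alpha+3,\ i-\ell,\ i-\ell}\right|1\right)\left(\frac{x-1}{2}\right)^{\ell+1}.$$ The generalized Jacobi polynomials $P_n^{\alpha,\beta,M,N}$ (mentioned only for orientation) are the polynomials of degree $n$ orthogonal on $[-1,1]$ with respect to $\frac{\Gamma(\alpha+\beta+2)}{2^{\alpha+\beta+1}\Gamma(\alpha+1)\Gamma(\beta+1)}(1-x)^{\alpha}(1+x)^{\beta}+M\delta(x+1)+N\delta(x-1)$. *)

(* Defs.v *)
From mathcomp Require Import all_boot all_order all_algebra.
From mathcomp Require Import boolp classical_sets cardinality reals.

Set Implicit Arguments.
Unset Strict Implicit.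
Unset Printing Implicit Defensive.

Import Order.TTheory GRing.Theory Num.Theory.

Local Open Scope ring_scope.

(* (a)_k = a (a + 1) ... (a + k - 1) *)
Definition poch (R : realType) (a : R) (k : nat) : R :=
  \prod_(j < k) (a + j%:R).

(* The terminating series pFq(-l, num; den | z): the numerator parameter -l is
   not listed in num, and the sum stops at k = l because (-l)_k = 0 for k > l. *)
Definition hypergeom (R : realType) (l : nat) (num den : seq R) (z : R) : R :=
  \sum_(k < l.+1)
     (poch (- l%:R) k * \prod_(a <- num) poch a k) / (\prod_(b <- den) poch b k)
     * (z ^+ k / (k`!)%:R).

Section Coefficients.
Context {R : realType}.
Variables (alpha beta : R) (n : nat).

Definition a0 : R :=
  if n == 0%N then 0 else
  (alpha + beta + 2) *
  ((poch (beta + 3) (n - 1) * poch (alpha + beta + 3) (n - 1)) /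
   (poch (alpha + 1) (n - 1) * ((n - 1)`!)%:R)).

Definition b0 : R :=
  if n == 0%N then 0 else
  (alpha + beta + 2) *
  ((poch (alpha + 3) (n - 1) * poch (alpha + beta + 3) (n - 1)) /
   (poch (beta + 1) (n - 1) * ((n - 1)`!)%:R)).

Definition c0 : R :=
  if (n <= 1)%N then 0 else
  ((alpha + beta + 2) ^+ 2 * (alpha + beta + 3)) / ((alpha + 1) * (beta + 1)) *
  (poch (alpha + beta + 4) (n - 1) / ((n - 1)`!)%:R) *
  (poch (alpha + beta + 4) (n - 2) / ((n - 2)`!)%:R).

(* In all the sums below l < i (resp. l < i - 1), so that the truncated
   subtractions i - l, i - l - 1 and i - l - 2 are genuine ones. *)
Definition a_pos (i : nat) (x : R) : R :=
  - (alpha + beta + 2) * 2 ^+ i *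
  \sum_(l < i)
    (-1) ^+ l *
    ((poch (beta + 3) (i - l - 1) * poch (- beta - 2) (i - l - 1)) /
     (poch (alpha + 1) (i - l - 1) *
        ((i - l)`!)%:R * ((i - l - 1)`!)%:R * (l`!)%:R)) *
    hypergeom l [:: alpha + beta + 3; beta + (i - l)%:R + 2]
                [:: alpha + (i - l)%:R; (i - l)%:R + 1] 1 *
    ((x + 1) / 2) ^+ l.+1.

Definition b_pos (i : nat) (x : R) : R :=
  (alpha + beta + 2) * (-2) ^+ i *
  \sum_(l < i)
    ((poch (alpha + 3) (i - l - 1) * poch (- alpha - 2) (i - l - 1)) /
     (poch (beta + 1) (i - l - 1) *
        ((i - l)`!)%:R * ((i - l - 1)`!)%:R * (l`!)%:R)) *
    hypergeom l [:: alpha + beta + 3; alpha + (i - l)%:R + 2]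
                [:: beta + (i - l)%:R; (i - l)%:R + 1] 1 *
    ((x - 1) / 2) ^+ l.+1.

Definition c_pos1 (i : nat) (x : R) : R :=
  - (((alpha + beta + 2) ^+ 2 * (alpha + beta + 3) * (alpha + beta + 4)) /
     ((alpha + 1) * (beta + 1) * i%:R)) * (x ^+ 2 - 1) * 2 ^+ (i - 2) *
  \sum_(l < i - 1)
    (-1) ^+ l *
    ((poch (beta + 3) (i - l - 2) * poch (- alpha - beta - 3) (i - l - 2)) /
     (((i - l - 1)`!)%:R * ((i - l - 2)`!)%:R * (l`!)%:R
        * ((i - l - 1)`!)%:R)) *
    hypergeom l [:: alpha + beta + 5; alpha + beta + 4; beta + (i - l)%:R + 1]
                [:: beta + 3; (i - l)%:R; (i - l)%:R] 1 *
    ((x + 1) / 2) ^+ l.+1.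

Definition c_pos2 (i : nat) (x : R) : R :=
  ((alpha + beta + 2) ^+ 2 * (alpha + beta + 3) * (alpha + beta + 4)) /
  ((alpha + 1) * (beta + 1) * i%:R) * (x ^+ 2 - 1) * (-2) ^+ (i - 2) *
  \sum_(l < i - 1)
    ((poch (alpha + 3) (i - l - 2) * poch (- alpha - beta - 3) (i - l - 2)) /
     (((i - l - 1)`!)%:R * ((i - l - 2)`!)%:R * (l`!)%:R
        * ((i - l - 1)`!)%:R)) *
    hypergeom l [:: alpha + beta + 5; alpha + beta + 4; alpha + (i - l)%:R + 1]
                [:: alpha + 3; (i - l)%:R; (i - l)%:R] 1 *
    ((x - 1) / 2) ^+ l.+1.

Definition a_coef (i : nat) (x : R) : R :=
  if i == 0%N then a0 else a_pos i x.

Definition b_coef (i : nat) (x : R) : R :=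
  if i == 0%N then b0 else b_pos i x.

Definition c_coef (i : nat) (x : R) : R :=
  match i with
  | 0 => c0
  | 1 => 0
  | _ => c_pos1 i x + c_pos2 i x
  end.

(* Coefficient of y^(i) in the second-order Jacobi equation
   (1 - x^2) y'' + [beta - alpha - (alpha + beta + 2) x] y'
     + n (n + alpha + beta + 1) y = 0. *)
Definition jacobi_coef (i : nat) (x : R) : R :=
  match i with
  | 0 => n%:R * (n%:R + alpha + beta + 1)
  | 1 => beta - alpha - (alpha + beta + 2) * x
  | 2 => 1 - x ^+ 2
  | _ => 0
  end.

(* The total coefficient of y^(i) in the equation
   M sum_i a_i y^(i) + N sum_i b_i y^(i) + M N sum_i c_i y^(i)
     + (1 - x^2) y'' + [beta - alpha - (alpha + beta + 2) x] y'
     + n (n + alpha + beta + 1) y = 0. *)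
Definition gen_jacobi_coef (M N : R) (i : nat) (x : R) : R :=
  M * a_coef i x + N * b_coef i x + M * N * c_coef i x + jacobi_coef i x.

End Coefficients.

(* A linear differential equation sum_i p_i(x) y^(i)(x) = 0, possibly with
   infinitely many terms, is represented by its coefficients p : nat -> R -> R. *)
Section Order.
Context {R : realType}.
Variable p : nat -> R -> R.

Definition coef_support : set nat :=
  [set i : nat | exists x : R, p i x != 0]%classic.

Definition ode_order_eq (d : nat) : Prop :=
  coef_support d /\ (forall i : nat, coef_support i -> (i <= d)%N).

Definition ode_order_infinite : Prop := infinite_set coef_support.

End Order.

(* Main.v *)
Require Import Defs.
From mathcomp Require Import all_boot all_order all_algebra.
From mathcomp Require Import boolp classical_sets cardinality reals.
From mathcomp Require Import zify ring lra.

Import Order.TTheory GRing.Theory Num.Theory.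

Local Open Scope ring_scope.

(* The coefficients [b_i] and [c_i^(2)] are the mirror images of [a_i] and
   [c_i^(1)] under x -> -x, alpha <-> beta.  If neither parameter is a natural
   number, evaluate at x = 1: there [b_i] and [c_i] vanish, while two
   Chu-Vandermonde summations give
   a_i(1) = - (alpha + beta + 2) 2^i (beta + 3 - i)_(i-1) / (i! (i-1)!) != 0
   (use x = -1 if M = 0).

   For natural parameters the numerator and denominator parameters of the
   hypergeometric series differ by integers, so each series is an l-th finite
   difference of a product of linear factors: it vanishes if there are fewer
   than l factors, and is explicit for l or l + 1 factors.  With y = (x + 1)/2
   this makes a_(2 beta + 4) a nonzero multiple of (y (y - 1))^(beta + 2) and
   kills all later [a_i].  With S = alpha + beta + 3, [c_i] is 0 for
   i > 2 S + 1; at i = 2 S + 1 both c^(1) and c^(2) are multiples of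
   (y (y - 1))^S and cancel; at i = 2 S they are
   (y (y - 1))^(S - 1) times linear polynomials in y whose sum is a nonzero
   constant. *)

(** * Pochhammer symbols and the Chu-Vandermonde sum *)

Section Pochhammer.
Context {R : realType}.
Implicit Types (a b x y t : R) (s : seq R).

Lemma poch0 a : poch a 0 = 1.
Proof. by rewrite /poch big_ord0. Qed.

Lemma pochS a k : poch a k.+1 = poch a k * (a + k%:R).
Proof. by rewrite /poch big_ord_recr. Qed.

Lemma pochD a m k : poch a (m + k) = poch a m * poch (a + m%:R) k.
Proof.
elim: k => [|k IH]; first by rewrite addn0 poch0 mulr1.
by rewrite addnS !pochS IH natrD; ring.
Qed.

Lemma poch_gt0 a k : 0 < a -> 0 < poch a k.
Proof. by move=> a0; apply: prodr_gt0 => i _; rewrite ltr_wpDr. Qed.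

Lemma poch_neq0 a k : 0 < a -> poch a k != 0.
Proof. by move=> a0; rewrite gt_eqF ?poch_gt0. Qed.

Lemma natr_fact_neq0 k : (k`!)%:R != 0 :> R.
Proof. by rewrite pnatr_eq0 -lt0n fact_gt0. Qed.

Lemma poch_fact m k : (m`!)%:R * poch (m%:R + 1 : R) k = ((m + k)`!)%:R.
Proof.
elim: k => [|k IH]; first by rewrite addn0 poch0 mulr1.
by rewrite addnS pochS mulrA IH factS natrM -addn1 !natrD; ring.
Qed.

Lemma poch_opp_nat n k :
  poch (- n%:R : R) k = (-1) ^+ k * ('C(n, k))%:R * (k`!)%:R.
Proof.
elim: k => [|k IH]; first by rewrite poch0 bin0 fact0 !mulr1.
rewrite pochS IH factS natrM exprS.
(* The recursion (k + 1) C(n, k + 1) = (n - k) C(n, k) passes to [R] only where the subtraction is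
   genuine; beyond [n] both sides are 0. *)
have [kn|nk] := leqP k n; last first.
  by rewrite !bin_small ?ltnS ?(ltnW nk) // !(mulr0, mul0r).
have /(congr1 (fun n => n%:R : R)) := mul_bin_left n k.
rewrite !natrM natrB // => E.
transitivity ((-1) ^+ k * (k`!)%:R * (- ((n%:R - k%:R) * ('C(n, k))%:R) : R)).
  by ring.
by rewrite -E; ring.
Qed.

Lemma poch_opp_fact l k : (k <= l)%N ->
  poch (- l%:R : R) k / (l`!)%:R = (-1) ^+ k / ((l - k)`!)%:R.
Proof.
move=> kl; rewrite poch_opp_nat -(bin_fact kl) !natrM.
have C0 : ('C(l, k))%:R != 0 :> R by rewrite pnatr_eq0 -lt0n bin_gt0.
by field; rewrite C0 !natr_fact_neq0.
Qed.

(* The coefficient of z^k in (1 - z)^(-a). *)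
Definition npoch a k : R := poch a k / (k`!)%:R.

Lemma npoch0 a : npoch a 0 = 1.
Proof. by rewrite /npoch poch0 fact0 divr1. Qed.

Lemma npochS a k : k.+1%:R * npoch a k.+1 = (a + k%:R) * npoch a k.
Proof.
rewrite /npoch pochS factS natrM; field.
by rewrite natr_fact_neq0 /= nat1r pnatr_eq0.
Qed.

Lemma npoch_opp_nat n k : npoch (- n%:R) k = (-1) ^+ k * ('C(n, k))%:R.
Proof. by rewrite /npoch poch_opp_nat mulfK ?natr_fact_neq0. Qed.

(** Induction on [n]: multiply by n + 1 = k + (n + 1 - k) and apply [npochS] to either factor; after
    an index shift the weights add up to (a + k) + (b + n - k) = a + b + n. *)
Lemma vandermonde_npoch a b n :
  \sum_(k < n.+1) npoch a k * npoch b (n - k) = npoch (a + b) n.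
Proof.
elim: n => [|n IH]; first by rewrite big_ord_recl big_ord0 !npoch0 mulr1 addr0.
apply: (@mulfI _ (n.+1%:R)); first by rewrite pnatr_eq0.
rewrite npochS -IH mulr_sumr.
transitivity
   (\sum_(k < n.+2) (k%:R * npoch a k * npoch b (n.+1 - k))
   + \sum_(k < n.+2) (npoch a k * ((n.+1 - k)%:R * npoch b (n.+1 - k)))).
  rewrite -big_split /=; apply: eq_bigr => k _.
  by rewrite natrB ?(leq_ord k) //; ring.
rewrite big_ord_recl /= !mul0r add0r.
rewrite [X in _ + X]big_ord_recr /= subnn mul0r mulr0 addr0.
rewrite -big_split mulr_sumr /=; apply: eq_bigr => k _.
have kn : (k <= n)%N := leq_ord k.
rewrite subSS subSn // !npochS natrB //; ring.
Qed.

Lemma sum_triangle n (F : nat -> nat -> R) :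
  \sum_(l < n) \sum_(k < l.+1) F l k
  = \sum_(q < n) \sum_(k < n - q) F (q + k)%N k.
Proof.
elim: n => [|n IH]; first by rewrite !big_ord0.
rewrite big_ord_recr /= IH.
(* The new row l = n adds one term to each diagonal q, the one with k = n - q. *)
transitivity (\sum_(q < n.+1)
   (\sum_(k < n - q) F (q + k)%N k + F n (n - q)%N)); last first.
  apply: eq_bigr => q _.
  have qn : (q <= n)%N := leq_ord q.
  by rewrite subSn // big_ord_recr /= subnKC.
rewrite big_split /= [in RHS]big_ord_recr /= subnn big_ord0 addr0; congr (_ + _).
by rewrite (reindex_inj rev_ord_inj) /=; apply: eq_bigr => k _; rewrite subSS.
Qed.

(** * Finite differences of products of linear factors *)

(** This is (-1)^l times the l-th forward difference of [Q] at 0. *)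
Definition fdiff l (Q : nat -> R) : R :=
  \sum_(k < l.+1) (-1) ^+ k * ('C(l, k))%:R * Q k.

Definition lin_prod s (k : nat) : R := \prod_(t <- s) (k%:R + t).

(** Split the factor k + t. In the part with k, the identity k C(l + 1, k) = (l + 1) C(l, k - 1)
    lowers the order of the difference, and the index shift adds 1 to the remaining factors. *)
Lemma fdiff_lin_cons l t s :
  fdiff l.+1 (lin_prod (t :: s)) =
  t * fdiff l.+1 (lin_prod s) - l.+1%:R * fdiff l (lin_prod [seq 1 + u | u <- s]).
Proof.
rewrite {1}/fdiff.
transitivity (t * fdiff l.+1 (lin_prod s) + \sum_(k < l.+2)
   (-1) ^+ k * (k * 'C(l.+1, k))%:R * lin_prod s k).
  rewrite /fdiff mulr_sumr -big_split; apply: eq_bigr => k _ /=.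
  by rewrite /lin_prod big_cons natrM; ring.
congr (_ + _); rewrite big_ord_recl /= mul0n mulr0 mul0r add0r.
rewrite /fdiff mulr_sumr -sumrN; apply: eq_bigr => k _.
rewrite /bump /= add1n -mul_bin_diag natrM exprS.
have -> : lin_prod [seq 1 + u | u <- s] k = lin_prod s k.+1.
  by rewrite /lin_prod big_map; apply: eq_bigr => u _; rewrite -(addn1 k) natrD; ring.
by ring.
Qed.

Lemma fdiff_lin_lt l s : (size s < l)%N -> fdiff l (lin_prod s) = 0.
Proof.
move Es: (size s) => n; elim: n s Es l => [|n IH] [|t s] //= => [_|[sn]] [|l] // nl.
  rewrite /fdiff; transitivity ((1 - 1 : R) ^+ l.+1).
    rewrite exprBn; apply: eq_bigr => k _.
    by rewrite /lin_prod big_nil !expr1n !mulr1 mulr_natr.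
  by rewrite subrr expr0n.
rewrite fdiff_lin_cons !IH ?size_map //; first by rewrite !mulr0 subr0.
exact: (@ltnW n.+1).
Qed.

Lemma fdiff_lin_eq l s : size s = l ->
  fdiff l (lin_prod s) = (-1) ^+ l * (l`!)%:R.
Proof.
elim: l s => [|l IH] [|t s] //= => [_|[sl]].
  by rewrite /fdiff big_ord_recl big_ord0 /lin_prod big_nil; ring.
rewrite fdiff_lin_cons fdiff_lin_lt ?sl // IH ?size_map //.
by rewrite factS natrM exprS; ring.
Qed.

(** For a monic polynomial of degree l + 1 only the two leading coefficients matter: l (l + 1) / 2
    comes from k^(l + 1), and the sum of the shifts is the coefficient of k^l. *)
Lemma fdiff_lin_succ l s : size s = l.+1 ->
  fdiff l (lin_prod s) =
  (-1) ^+ l * (l`!)%:R * (l%:R * (l%:R + 1) / 2 + \sum_(t <- s) t).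
Proof.
elim: l s => [|l IH] [|t s] //= [sl].
  case: s sl => // _.
  rewrite /fdiff big_ord_recl big_ord0 /lin_prod !big_cons !big_nil /=.
  by rewrite bin0 fact0; ring.
rewrite fdiff_lin_cons fdiff_lin_eq // IH ?size_map //.
rewrite big_cons big_map big_split /= big_const_seq count_predT sl iter_addr_0.
rewrite factS natrM exprS -addn1 !natrD; by field.
Qed.

Definition shifts a n : seq R := [seq a + j%:R | j <- iota 0 n].

Lemma size_shifts a n : size (shifts a n) = n.
Proof. by rewrite size_map size_iota. Qed.

Lemma sum_shifts a n :
  \sum_(t <- shifts a n) t = n%:R * a + n%:R * (n%:R - 1) / 2.
Proof.
elim: n => [|n IH]; first by rewrite big_nil; ring.
move: IH; rewrite /shifts -(addn1 n) iotaD map_cat big_cat /= => ->.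
rewrite big_cons big_nil add0n natrD; by field.
Qed.

(** Both (a)_n (a + n)_k and (a)_k (a + k)_n equal (a)_(n + k), so the quotient (b)_k / (a)_k is a
    polynomial in k of degree n. *)
Lemma poch_ratio a b n k : 0 < a -> b = a + n%:R ->
  poch b k = (poch a k / poch a n) * lin_prod (shifts a n) k.
Proof.
move=> a0 ->.
have -> : lin_prod (shifts a n) k = poch (a + k%:R) n.
  rewrite /lin_prod big_map /poch -{1}[n]subn0 -/(index_iota 0 n) big_mkord.
  by apply: eq_bigr => j _; ring.
apply: (mulfI (poch_neq0 _ n a0)).
by rewrite -pochD addnC pochD; field; rewrite poch_neq0.
Qed.

Lemma hypergeom_lin l num den s c :
  (forall k, \prod_(a <- num) poch a k / \prod_(b <- den) poch b k
             = c * lin_prod s k) ->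
  hypergeom l num den 1 = c * fdiff l (lin_prod s).
Proof.
move=> H; rewrite /hypergeom /fdiff mulr_sumr; apply: eq_bigr => k _.
transitivity (npoch (- l%:R) k *
  (\prod_(a <- num) poch a k / \prod_(b <- den) poch b k)).
  by rewrite /npoch expr1n; ring.
by rewrite H npoch_opp_nat; ring.
Qed.

(** * Signed binomial sums *)

(** With k = S + r - l this is the binomial expansion of (y - 1)^S; the terms with k > S vanish. *)
Lemma sum_signed_bin S r y :
  \sum_(l < S + r.+1) (-1) ^+ (S + r - l) * ('C(S, S + r - l))%:R * y ^+ l.+1
  = y ^+ r.+1 * (y - 1) ^+ S.
Proof.
rewrite (reindex_inj rev_ord_inj) /= -addSnnS big_split_ord /= [X in _ + X]big1.
  rewrite addr0 exprBn mulr_sumr; apply: eq_bigr => k _.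
  have kS : (k <= S)%N := leq_ord k.
  have -> : (S + r - (S.+1 + r - k.+1) = k)%N by lia.
  have -> : ((S.+1 + r - k.+1).+1 = r.+1 + (S - k))%N by lia.
  by rewrite expr1n exprD -mulr_natr; ring.
move=> k _; have kr := ltn_ord k.
by rewrite bin_small ?mulr0n ?mulr0 ?mul0r //; lia.
Qed.

Lemma sum_signed_bin_mul S r y :
  \sum_(l < S.+1 + r.+1) (-1) ^+ (S.+1 + r - l) * ('C(S.+1, S.+1 + r - l))%:R
     * (S.+1 + r - l)%:R * y ^+ l.+1
  = - S.+1%:R * y ^+ r.+1 * (y - 1) ^+ S.
Proof.
rewrite -mulrA -sum_signed_bin mulr_sumr addSn big_ord_recr /=.
have -> : (S.+1 + r - (S + r.+1) = 0)%N by lia.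
rewrite mulr0 mul0r addr0; apply: eq_bigr => l _.
have lS := ltn_ord l.
have -> : (S.+1 + r - l = (S + r - l).+1)%N by lia.
have /(congr1 (fun n => n%:R : R)) := mul_bin_diag S.+1 (S + r - l).
rewrite /= !natrM => E.
transitivity (- (-1) ^+ (S + r - l) * y ^+ l.+1 *
  ((S + r - l).+1%:R * ('C(S.+1, (S + r - l).+1))%:R)).
  by rewrite exprS; ring.
by rewrite -E; ring.
Qed.

End Pochhammer.

(** * Mirror symmetry and values at the end points *)

Section Coefficients.
Context {R : realType}.
Implicit Types (alpha beta x y : R).

Lemma b_pos_symm alpha beta i x :
  b_pos alpha beta i x = (-1) ^+ i * a_pos beta alpha i (- x).
Proof.
rewrite /b_pos /a_pos !mulr_sumr; apply: eq_bigr => l _.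
rewrite (addrC beta alpha).
have -> : (- x + 1) / 2 = (-1) * ((x - 1) / 2) by ring.
have -> : (-2 : R) ^+ i = (-1) ^+ i * 2 ^+ i by rewrite -exprMn mulN1r.
rewrite [in RHS]exprMn [(-1) ^+ l.+1]exprS.
(* The right side carries (-1)^l twice, from [a_pos] and from the power of (- x + 1) / 2; the square
   is inserted on the left so that [ring] can match. *)
rewrite -[LHS]mulr1 -[X in _ * X = _](sqrr_sign R l).
ring.
Qed.

Lemma c_pos2_symm alpha beta i x : (2 <= i)%N ->
  c_pos2 alpha beta i x = (-1) ^+ i * c_pos1 beta alpha i (- x).
Proof.
case: i => [|[|i]] // _.
rewrite /c_pos1 /c_pos2 !mulr_sumr; apply: eq_bigr => l _.
rewrite (addrC beta alpha) (addrC (- beta) (- alpha)) sqrrN (mulrC (beta + 1)).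
have -> : (- x + 1) / 2 = (-1) * ((x - 1) / 2) by ring.
have -> : (-2 : R) ^+ (i.+2 - 2) = (-1) ^+ i.+2 * 2 ^+ (i.+2 - 2).
  by rewrite subn2 /= !exprS !mulN1r opprK -exprMn mulN1r.
rewrite [in RHS]exprMn [(-1) ^+ l.+1]exprS.
rewrite -[LHS]mulr1 -[X in _ * X = _](sqrr_sign R l).
ring.
Qed.

Lemma a_pos_opp1 alpha beta i : a_pos alpha beta i (-1) = 0.
Proof.
rewrite /a_pos big1 ?mulr0 // => l _.
by rewrite addNr mul0r expr0n mulr0.
Qed.

Lemma b_pos_one alpha beta i : b_pos alpha beta i 1 = 0.
Proof. by rewrite b_pos_symm a_pos_opp1 mulr0. Qed.

Lemma c_coef_one alpha beta n i : c_coef alpha beta n i.+1 1 = 0.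
Proof.
case: i => [|i] //=.
by rewrite /c_pos1 /c_pos2 expr1n subrr !(mulr0, mul0r) addr0.
Qed.

(* The Pochhammer symbols of the coefficient and of its 3F2 merge
   into symbols of the total index [i - q], [q = l - k]; the sum over fixed [q]
   and then the sum over [q] are Chu-Vandermonde sums. *)
Lemma a_pos_one alpha beta i : -1 < alpha ->
  a_pos alpha beta i.+1 1 =
  - (alpha + beta + 2) * 2 ^+ i.+1 / (i.+1`!)%:R * npoch (beta + 2 - i%:R) i.
Proof.
have ha1 : -1 < alpha -> 0 < alpha + 1 by lra.
move=> /ha1 {}ha1; rewrite /a_pos -[in RHS]mulrA; congr (_ * _).
pose F l k : R := (-1) ^+ (l - k) * poch (beta + 3) (i - (l - k))
  / (poch (alpha + 1) (i - (l - k)) * (((i - (l - k)).+1)`!)%:R * ((l - k)`!)%:R)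
  * (npoch (alpha + beta + 3) k * npoch (- beta - 2) (i - l)).
transitivity (\sum_(l < i.+1) \sum_(k < l.+1) F l k).
  apply: eq_bigr => l _.
  rewrite /hypergeom mulr_sumr mulr_suml; apply: eq_bigr => k _.
  have li : (l <= i)%N := leq_ord l.
  have kl : (k <= l)%N := leq_ord k.
  rewrite !big_cons !big_nil !expr1n /F /npoch.
  have -> : (i.+1 - l = (i - l).+1)%N by lia.
  have -> : ((i - l).+1 - 1 = i - l)%N by lia.
  have -> : (i - (l - k) = (i - l) + k)%N by lia.
  rewrite !pochD -!addSn -(poch_fact _ k).
  have -> : beta + ((i - l).+1)%:R + 2 = beta + 3 + (i - l)%:R.
    by rewrite -addn1 natrD; ring.
  have -> : alpha + ((i - l).+1)%:R = alpha + 1 + (i - l)%:R.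
    by rewrite -addn1 natrD; ring.
  have E := @poch_opp_fact R l k kl.
  have -> : (1 + 1) / 2 = 1 :> R by field.
  rewrite expr1n.
  have -> : poch (- l%:R : R) k = (-1) ^+ k / ((l - k)`!)%:R * (l`!)%:R.
    by rewrite -E divfK ?natr_fact_neq0.
  have -> : (-1) ^+ (l - k) = (-1) ^+ l * (-1) ^+ k :> R.
    by rewrite -signr_odd oddB // signr_addb !signr_odd.
  field.
  by rewrite !natr_fact_neq0 !poch_neq0 // ltr_wpDr.
rewrite sum_triangle.
transitivity (\sum_(q < i.+1) ((i.+1)`!)%:R^-1 *
   (npoch (- (i.+1)%:R) q * npoch (beta + 3 : R) (i - q))).
  apply: eq_bigr => q _.
  have qi : (q <= i)%N := leq_ord q.
  rewrite subSn //.
  transitivity ((-1) ^+ q * poch (beta + 3) (i - q)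
    / (poch (alpha + 1) (i - q) * (((i - q).+1)`!)%:R * (q`!)%:R)
    * npoch (alpha + 1) (i - q)).
    (* This splitting makes the sum over [k] a Vandermonde sum, whose value cancels the denominator
       [poch (alpha + 1) (i - q)]. *)
    have -> : alpha + 1 = (alpha + beta + 3) + (- beta - 2) by ring.
    rewrite -vandermonde_npoch mulr_sumr; apply: eq_bigr => k _.
    have ki : (k <= i - q)%N := leq_ord k.
    by rewrite /F addnK subnDA; congr (_ / (poch _ _ * _ * _) * _); ring.
  rewrite npoch_opp_nat.
  have qi1 : (q <= i.+1)%N by lia.
  have -> : ((i.+1)`!)%:R = ('C(i.+1, q))%:R * (q`!)%:R * (((i - q).+1)`!)%:R :> R.
    by rewrite -!natrM -mulnA -subSn // bin_fact.
  rewrite /npoch.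
  field.
  by rewrite !natr_fact_neq0 poch_neq0 // pnatr_eq0 -lt0n bin_gt0 qi1.
(* The second Vandermonde sum has parameters - (i + 1) and beta + 3, whence beta + 2 - i. *)
rewrite -mulr_sumr vandermonde_npoch; congr (_ * _).
by congr npoch; rewrite -addn1 natrD; ring.
Qed.

End Coefficients.

(** * Explicit coefficients for natural parameters *)

Section Naturals.
Context {R : realType}.
Implicit Types (alpha beta x y : R).

Lemma lin_prod_cat (s t : seq R) k :
  lin_prod (s ++ t) k = lin_prod s k * lin_prod t k.
Proof. by rewrite /lin_prod big_cat. Qed.

(* [m] stands for i - l - 1 in [a_shifts] and for i - l - 2 in [c_shifts]. *)
Definition a_shifts alpha (b m : nat) : seq R :=
  shifts (alpha + 1 + m%:R) (b + 2 - m) ++ shifts (m%:R + 2) b.+1.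

Definition c_shifts (a b m : nat) : seq R :=
  shifts (m%:R + 2) (a + b + 3 - m) ++ shifts (b%:R + 3) a.+1
  ++ shifts (m%:R + 2) b.+1.

(** With m = i - l, the parameters alpha + b + 3 and alpha + m + 1 differ by b + 2 - m, and b + m +
    3 and m + 2 differ by b + 1. The case m > b + 2, where the first difference is negative, is
    killed by (- b - 2)_m. *)
Lemma a_pos_nat alpha b i x : -1 < alpha ->
  a_pos alpha b%:R i.+1 x =
  - (alpha + b%:R + 2) * 2 ^+ i.+1 / (poch (alpha + 1) (b + 2) * ((b + 2)`!)%:R)
  * \sum_(l < i.+1) (-1) ^+ (i - l) * ('C(b + 2, i - l))%:R
      * ((-1) ^+ l * fdiff l (lin_prod (a_shifts alpha b (i - l))) / (l`!)%:R)
      * ((x + 1) / 2) ^+ l.+1.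
Proof.
have ha1 : -1 < alpha -> 0 < alpha + 1 by lra.
move=> /ha1 {}ha1; rewrite /a_pos -[in RHS](mulrA (_ * _)); congr (_ * _).
rewrite mulr_sumr; apply: eq_bigr => l _; rewrite [RHS]mulrA; congr (_ * _).
have li : (l <= i)%N := leq_ord l.
have -> : (i.+1 - l = (i - l).+1)%N by lia.
have -> : ((i - l).+1 - 1 = i - l)%N by lia.
move: (i - l)%N => m; move: (nat_of_ord l) => {li}l.
have -> : - b%:R - 2 = - (b + 2)%:R :> R by rewrite natrD; ring.
rewrite poch_opp_nat.
have [mb|bm] := leqP m (b + 2); last by rewrite bin_small // !(mulr0, mul0r).
set c := (poch (alpha + 1 + m%:R) (b + 2 - m) * poch (m%:R + 2 : R) b.+1)^-1.
have am0 : 0 < alpha + 1 + m%:R by rewrite ltr_wpDr.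
have m20 : 0 < m%:R + 2 :> R by rewrite ltr_wpDl.
rewrite (@hypergeom_lin _ _ _ _ (a_shifts alpha b m) c); last first.
  move=> k; rewrite !big_cons !big_nil lin_prod_cat !mulr1.
  have -> : alpha + m.+1%:R = alpha + 1 + m%:R by rewrite -addn1 natrD; ring.
  have -> : m.+1%:R + 1 = m%:R + 2 :> R by rewrite -addn1 natrD; ring.
  rewrite (@poch_ratio _ (alpha + 1 + m%:R) (alpha + b%:R + 3) (b + 2 - m)) //;
    last by rewrite natrB // natrD; ring.
  rewrite (@poch_ratio _ (m%:R + 2) (b%:R + m.+1%:R + 2) b.+1) //;
    last by rewrite -(addn1 m) -(addn1 b) !natrD; ring.
  by rewrite /c; field; rewrite !poch_neq0.
have Ea : poch (alpha + 1) (b + 2) =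
    poch (alpha + 1) m * poch (alpha + 1 + m%:R) (b + 2 - m).
  by rewrite -pochD subnKC.
(* Since (b + 3)_m (b + 2)! and (m + 1)! (m + 2)_(b + 1) are both (b + 2 + m)!, the binomial
   coefficient and its sign are all that depends on m outside the difference. *)
have Eb : poch (b%:R + 3 : R) m =
    ((m.+1)`!)%:R * poch (m%:R + 2 : R) b.+1 / ((b + 2)`!)%:R.
  have -> : m%:R + 2 = m.+1%:R + 1 :> R by rewrite -addn1 natrD; ring.
  have -> : b%:R + 3 = (b + 2)%:R + 1 :> R by rewrite natrD; ring.
  rewrite poch_fact; have -> : (m.+1 + b.+1 = b + 2 + m)%N by lia.
  by rewrite -poch_fact mulrAC divff ?mul1r ?natr_fact_neq0.
rewrite Ea Eb /c.
field; by rewrite !natr_fact_neq0 !poch_neq0.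
Qed.

(** With m = i - l, the pairs are a + b + 5 over m + 2, a + b + 4 over b + 3, and b + m + 3 over m +
    2. *)
Lemma c_pos1_nat a b i x :
  c_pos1 a%:R b%:R i.+2 x =
  - (((a%:R + b%:R + 2) ^+ 2 * (a%:R + b%:R + 3) * (a%:R + b%:R + 4)) /
     ((a%:R + 1) * (b%:R + 1) * i.+2%:R)) * (x ^+ 2 - 1) * 2 ^+ i
  / (((a + b + 4)`!)%:R * ((a + b + 3)`!)%:R)
  * \sum_(l < i.+1) (-1) ^+ (i - l) * ('C(a + b + 3, i - l))%:R
      * ((-1) ^+ l * fdiff l (lin_prod (c_shifts a b (i - l))) / (l`!)%:R)
      * ((x + 1) / 2) ^+ l.+1.
Proof.
rewrite /c_pos1 !subSS !subn0 -[in RHS](mulrA (_ * _ ^+ i)); congr (_ * _).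
rewrite mulr_sumr; apply: eq_bigr => l _; rewrite [RHS]mulrA; congr (_ * _).
have li : (l <= i)%N := leq_ord l.
have -> : (i.+2 - l = (i - l).+2)%N by lia.
have -> : ((i - l).+2 - 1 = (i - l).+1)%N by lia.
have -> : ((i - l).+2 - 2 = i - l)%N by lia.
move: (i - l)%N => m; move: (nat_of_ord l) => {li}l.
have -> : - a%:R - b%:R - 3 = - (a + b + 3)%:R :> R by rewrite !natrD; ring.
rewrite poch_opp_nat.
have [mb|bm] := leqP m (a + b + 3); last by rewrite bin_small // !(mulr0, mul0r).
set c := (poch (m%:R + 2 : R) (a + b + 3 - m) * poch (b%:R + 3) a.+1
  * poch (m%:R + 2 : R) b.+1)^-1.
have b30 : 0 < b%:R + 3 :> R by rewrite ltr_wpDl.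
have m20 : 0 < m%:R + 2 :> R by rewrite ltr_wpDl.
rewrite (@hypergeom_lin _ _ _ _ (c_shifts a b m) c); last first.
  move=> k; rewrite !big_cons !big_nil !lin_prod_cat !mulr1.
  have -> : m.+2%:R = m%:R + 2 :> R by rewrite -addn2 natrD; ring.
  rewrite (@poch_ratio _ (m%:R + 2) (a%:R + b%:R + 5) (a + b + 3 - m)) //;
    last by rewrite natrB // !natrD; ring.
  rewrite (@poch_ratio _ (b%:R + 3) (a%:R + b%:R + 4) a.+1) //;
    last by rewrite -(addn1 a) !natrD; ring.
  rewrite (@poch_ratio _ (m%:R + 2) (b%:R + (m%:R + 2) + 1) b.+1) //;
    last by rewrite -(addn1 b) !natrD; ring.
  by rewrite /c; field; rewrite !poch_neq0.
have m2E : m%:R + 2 = m.+1%:R + 1 :> R by rewrite -addn1 natrD; ring.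
have b3E : b%:R + 3 = (b + 2)%:R + 1 :> R by rewrite natrD; ring.
have Ea : ((a + b + 4)`!)%:R =
    ((m.+1)`!)%:R * poch (m%:R + 2 : R) (a + b + 3 - m).
  by rewrite m2E poch_fact; congr (_`!)%:R; lia.
have Eb : poch (b%:R + 3 : R) m =
    ((m.+1)`!)%:R * poch (m%:R + 2 : R) b.+1 / ((b + 2)`!)%:R.
  rewrite m2E b3E poch_fact; have -> : (m.+1 + b.+1 = b + 2 + m)%N by lia.
  by rewrite -poch_fact mulrAC divff ?mul1r ?natr_fact_neq0.
have Ec : ((a + b + 3)`!)%:R = ((b + 2)`!)%:R * poch (b%:R + 3 : R) a.+1.
  by rewrite b3E poch_fact; congr (_`!)%:R; lia.
rewrite Ea Eb Ec /c.
field; by rewrite !natr_fact_neq0 !poch_neq0.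
Qed.

Lemma size_a_shifts alpha b m : (m <= b + 2)%N ->
  size (a_shifts alpha b m) = (2 * b + 3 - m)%N.
Proof. by move=> mb; rewrite size_cat !size_shifts; lia. Qed.

Lemma size_c_shifts a b m : (m <= a + b + 3)%N ->
  size (c_shifts a b m) = (2 * (a + b) + 5 - m)%N.
Proof. by move=> mb; rewrite !size_cat !size_shifts; lia. Qed.

(** When its binomial is nonzero, term [l] is an l-th difference of 2 b + 4 - i + l linear factors,
    fewer than l. *)
Lemma a_pos_nat_eq0 alpha b i x : -1 < alpha -> (2 * b + 4 < i)%N ->
  a_pos alpha b%:R i x = 0.
Proof.
case: i => // i ha bi; rewrite a_pos_nat // big1 ?mulr0 // => l _.
have li : (l <= i)%N := leq_ord l.
have [mb|bm] := leqP (i - l) (b + 2); last first.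
  by rewrite bin_small // mulr0 !mul0r.
by rewrite fdiff_lin_lt ?size_a_shifts ?mulr0 ?mul0r ?mulr0 ?mul0r //; lia.
Qed.

Lemma c_pos1_nat_eq0 a b i x : (2 * (a + b) + 7 < i)%N ->
  c_pos1 a%:R b%:R i x = 0 :> R.
Proof.
case: i => [|[|i]] bi; try lia; rewrite c_pos1_nat // big1 ?mulr0 // => l _.
have li : (l <= i)%N := leq_ord l.
have [mb|bm] := leqP (i - l) (a + b + 3); last first.
  by rewrite bin_small // mulr0 !mul0r.
by rewrite fdiff_lin_lt ?size_c_shifts ?mulr0 ?mul0r ?mulr0 ?mul0r //; lia.
Qed.

Lemma a_pos_nat_top alpha b x (y := (x + 1) / 2) : -1 < alpha ->
  a_pos alpha b%:R (2 * b + 4) x =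
  - (alpha + b%:R + 2) * 2 ^+ (2 * b + 4)
  / (poch (alpha + 1) (b + 2) * ((b + 2)`!)%:R)
  * (y ^+ (b + 2) * (y - 1) ^+ (b + 2)).
Proof.
(* Now there are exactly l factors. The index is split for [sum_signed_bin] with S = b + 2 and r = b
   + 1. *)
move=> ha; have -> : (2 * b + 4 = (b + 2 + b.+1).+1)%N by lia.
rewrite a_pos_nat //; congr (_ * _); rewrite -addnS.
rewrite -/y [X in _ = y ^+ X * _]addn2 -sum_signed_bin.
apply: eq_bigr => l _; congr (_ * _).
have lb := ltn_ord l.
have [mb|bm] := leqP (b + 2 + b.+1 - l) (b + 2); last first.
  by rewrite bin_small // mulr0 !mul0r.
rewrite fdiff_lin_eq ?size_a_shifts //; last by lia.
rewrite -[RHS]mulr1; congr (_ * _).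
by rewrite mulrA -expr2 sqrr_sign mul1r divff ?natr_fact_neq0.
Qed.

Definition c_scale a b i x : R :=
  - (((a%:R + b%:R + 2) ^+ 2 * (a%:R + b%:R + 3) * (a%:R + b%:R + 4)) /
     ((a%:R + 1) * (b%:R + 1) * i.+2%:R)) * (x ^+ 2 - 1) * 2 ^+ i
  / (((a + b + 4)`!)%:R * ((a + b + 3)`!)%:R).

Lemma c_scale_symm a b i x : c_scale b a i (- x) = c_scale a b i x.
Proof.
by rewrite /c_scale sqrrN (addrC b%:R) (mulrC (b%:R + 1)) (addnC b).
Qed.

Lemma c_pos1_nat_above a b x (y := (x + 1) / 2) :
  c_pos1 a%:R b%:R (2 * (a + b) + 7) x =
  c_scale a b (2 * (a + b) + 5) x
  * (y ^+ (a + b + 3) * (y - 1) ^+ (a + b + 3)).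
Proof.
have -> : (2 * (a + b) + 7 = (2 * (a + b) + 5).+2)%N by lia.
rewrite c_pos1_nat; congr (_ * _).
have -> : (2 * (a + b) + 5 = a + b + 3 + (a + b + 2))%N by lia.
rewrite -addnS.
rewrite -/y [X in _ = y ^+ X * _](addnS (a + b) 2) -sum_signed_bin.
apply: eq_bigr => l _; congr (_ * _).
have lb := ltn_ord l.
have [mb|bm] := leqP (a + b + 3 + (a + b + 2) - l) (a + b + 3); last first.
  by rewrite bin_small // mulr0 !mul0r.
rewrite fdiff_lin_eq ?size_c_shifts //; last by lia.
rewrite -[RHS]mulr1; congr (_ * _).
by rewrite mulrA -expr2 sqrr_sign mul1r divff ?natr_fact_neq0.
Qed.

(** Here there are l + 1 factors. Substituting l = 2 S - 2 - m in [fdiff_lin_succ], the squares of m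
    cancel and 3 S^2 - S - (2 S - b - 1) m remains; the two signed binomial sums handle its two
    terms. *)
Lemma c_pos1_nat_top a b x (y := (x + 1) / 2) (S := a%:R + b%:R + 3 : R) :
  c_pos1 a%:R b%:R (2 * (a + b) + 6) x =
  c_scale a b (2 * (a + b) + 4) x * S
  * (((3 * S - 1) * (y - 1) + (2 * S - b%:R - 1))
     * (y ^+ (a + b + 2) * (y - 1) ^+ (a + b + 2))).
Proof.
have -> : (2 * (a + b) + 6 = (2 * (a + b) + 4).+2)%N by lia.
rewrite c_pos1_nat -[RHS]mulrA; congr (_ * _).
have -> : (2 * (a + b) + 4 = a + b + 3 + (a + b + 1))%N by lia.
rewrite -addnS.
transitivity ((3 * S ^+ 2 - S) * (y ^+ (a + b + 1).+1 * (y - 1) ^+ (a + b + 3))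
 - (2 * S - b%:R - 1) *
   (- (a + b + 2).+1%:R * y ^+ (a + b + 1).+1 * (y - 1) ^+ (a + b + 2))).
  rewrite -sum_signed_bin -sum_signed_bin_mul -(addnS (a + b) 2).
  rewrite !mulr_sumr -sumrB; apply: eq_bigr => l _.
  rewrite -/y [LHS]mulrAC.
  have lb := ltn_ord l.
  have [mb|bm] := leqP (a + b + 3 + (a + b + 1) - l) (a + b + 3); last first.
    by rewrite bin_small // mulr0 !mul0r !mulr0 subr0.
  rewrite fdiff_lin_succ ?size_c_shifts //; last by lia.
  have lE : l%:R = 2 * S - 2 - (a + b + 3 + (a + b + 1) - l)%:R :> R.
    by rewrite natrB ?natrD /S; [ring | lia].
  have -> W : (-1) ^+ l * ((-1) ^+ l * (l`!)%:R * W) / (l`!)%:R = W :> R.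
    by rewrite !mulrA -expr2 sqrr_sign mul1r mulrAC divff ?mul1r ?natr_fact_neq0.
  rewrite /c_shifts !big_cat !sum_shifts /= lE.
  move: (a + b + 3 + (a + b + 1) - l)%N mb => m mb.
  have -> : (a + b + 3 - m)%:R = S - m%:R by rewrite natrB // !natrD.
  rewrite -(addn1 a) -(addn1 b) !natrD /S; by field.
rewrite -addnS !addnS !addn0 !exprS -addn1 !natrD /S; ring.
Qed.

(** [c_scale] and y (y - 1) are invariant under the reflection, while the odd index gives the sign
    -1. *)
Lemma c_coef_nat_above a b n x :
  c_coef (a%:R : R) b%:R n (2 * (a + b) + 7) x = 0.
Proof.
have -> : c_coef (a%:R : R) b%:R n (2 * (a + b) + 7) x =
  c_pos1 a%:R b%:R (2 * (a + b) + 7) x + c_pos2 a%:R b%:R (2 * (a + b) + 7) x.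
  by rewrite addnS addnS.
rewrite c_pos2_symm; last by lia.
rewrite c_pos1_nat_above (addnC a b) c_pos1_nat_above (addnC b a) c_scale_symm.
have -> : (-1) ^+ (2 * (a + b) + 7) = -1 :> R.
  by rewrite -signr_odd; have -> : odd (2 * (a + b) + 7) by lia.
set y := (x + 1) / 2.
have -> : (- x + 1) / 2 = 1 - y by rewrite /y; field.
rewrite -!exprMn; have -> : (1 - y) * (1 - y - 1) = y * (y - 1) by ring.
by rewrite mulN1r subrr.
Qed.

(** The index is even, so the linear factor (3 S - 1) (y - 1) + 2 S - b - 1 and its mirror image -
    (3 S - 1) y + 2 S - a - 1 are added, giving S - a - b - 1 = 2. *)
Lemma c_coef_nat_top a b n x (y := (x + 1) / 2) :
  c_coef (a%:R : R) b%:R n (2 * (a + b) + 6) x =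
  2 * c_scale a b (2 * (a + b) + 4) x * (a%:R + b%:R + 3)
  * (y * (y - 1)) ^+ (a + b + 2).
Proof.
have -> : c_coef (a%:R : R) b%:R n (2 * (a + b) + 6) x =
  c_pos1 a%:R b%:R (2 * (a + b) + 6) x + c_pos2 a%:R b%:R (2 * (a + b) + 6) x.
  by rewrite addnS addnS.
rewrite c_pos2_symm; last by lia.
rewrite c_pos1_nat_top (addnC a b) c_pos1_nat_top (addnC b a) c_scale_symm.
have -> : (-1) ^+ (2 * (a + b) + 6) = 1 :> R.
  by rewrite -signr_odd; have -> : odd (2 * (a + b) + 6) = false by lia.
rewrite -/y; have -> : (- x + 1) / 2 = 1 - y by rewrite /y; field.
rewrite -!exprMn; have -> : (1 - y) * (1 - y - 1) = y * (y - 1) by ring.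
ring.
Qed.

End Naturals.

(** * The order of the equation *)

Section OrderOfEquation.
Context {R : realType}.
Implicit Types (alpha beta M N x : R).

Lemma gen_jacobi_coef_high alpha beta n M N i x : (2 < i)%N ->
  gen_jacobi_coef alpha beta n M N i x =
  M * a_pos alpha beta i x + N * b_pos alpha beta i x
  + M * N * c_coef alpha beta n i x.
Proof. by case: i => [|[|[|i]]] // _; rewrite /gen_jacobi_coef /= addr0. Qed.

Lemma a_pos_one_neq0 alpha beta i : -1 < alpha -> -1 < beta ->
  beta \isn't a Num.nat -> a_pos alpha beta i.+1 1 != 0.
Proof.
move=> ha hb bN; rewrite a_pos_one // /npoch.
rewrite !mulf_neq0 ?invr_neq0 ?natr_fact_neq0 ?expf_neq0 ?pnatr_eq0 //.
  by rewrite oppr_eq0 gt_eqF //; lra.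
rewrite /poch; apply/prodf_neq0 => j _; apply/negP => /eqP E.
have ji := ltn_ord j.
(* A zero factor means beta = i - j - 2. For j = i - 1 this is -1, excluded by -1 < beta; otherwise
   it is a natural number. *)
have [ij|ij] := leqP i j.+1.
  have iE : i%:R = j%:R + 1 :> R by rewrite natr1; congr _%:R; lia.
  by lra.
move: bN; have -> : beta = (i - j.+2)%:R; last by rewrite natr_nat.
by rewrite natrB // -addn2 natrD; lra.
Qed.

Lemma ode_order_infinite_of_high (p : nat -> R -> R) x k :
  (forall i, (k <= i)%N -> p i x != 0) -> ode_order_infinite p.
Proof.
move=> pk; apply: (@sub_infinite_set _ ([set: nat] `\` `I_k)%classic).
  move=> i [_ /= /negP]; rewrite -leqNgt => ki; exists x; exact: pk.
by apply: infinite_setD; [exact: infinite_nat | exact: finite_II].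
Qed.

Lemma ode_order_eqP (p : nat -> R -> R) x d : p d x != 0 ->
  (forall i y, (d < i)%N -> p i y = 0) -> ode_order_eq p d.
Proof.
move=> pd pi; split; first by exists x.
move=> i [y py]; rewrite leqNgt; apply/negP => di.
by rewrite pi ?eqxx in py.
Qed.

Lemma a_pos_nat_top_neq0 alpha b : -1 < alpha ->
  a_pos alpha b%:R (2 * b + 4) 3 != 0 :> R.
Proof.
move=> ha; rewrite a_pos_nat_top //.
have b0 : 0 <= b%:R :> R by [].
(* The point x = 3 gives y = 2 and y - 1 = 1, so no power of y (y - 1) vanishes. *)
have -> : (3 + 1) / 2 = 2 :> R by field.
have -> : 2 - 1 = 1 :> R by ring.
have pre0 : - (alpha + b%:R + 2) != 0 by apply/eqP; lra.
have poch_n0 : poch (alpha + 1) (b + 2) != 0 by apply: poch_neq0; lra.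
by rewrite !mulf_neq0 ?invr_neq0 ?mulf_neq0 ?natr_fact_neq0 ?expf_neq0
  ?pnatr_eq0 ?oner_neq0.
Qed.

Lemma c_coef_nat_top_neq0 a b n :
  c_coef (a%:R : R) b%:R n (2 * (a + b) + 6) 3 != 0.
Proof.
rewrite c_coef_nat_top.
have a0 : 0 <= a%:R :> R by [].
have b0 : 0 <= b%:R :> R by [].
have -> : (3 + 1) / 2 = 2 :> R by field.
have -> : 2 - 1 = 1 :> R by ring.
rewrite /c_scale.
have k0 : ((2 * (a + b) + 4).+2)%:R != 0 :> R by rewrite pnatr_eq0.
rewrite !mulf_neq0 ?oppr_eq0 ?mulf_neq0 ?invr_neq0 ?mulf_neq0
  ?natr_fact_neq0 ?expf_neq0 //; by apply/eqP; lra.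
Qed.

Lemma c_coef_nat_eq0 a b n i x : (2 * (a + b) + 6 < i)%N ->
  c_coef (a%:R : R) b%:R n i x = 0.
Proof.
rewrite leq_eqVlt => /orP[/eqP <-|]; first by rewrite -addnS c_coef_nat_above.
case: i => [|[|i]] // abi; rewrite /c_coef c_pos2_symm //.
by rewrite !c_pos1_nat_eq0 ?mulr0 ?addr0 // 1?addnC; lia.
Qed.

End OrderOfEquation.

Theorem mainTheorem3 (R : realType) (alpha beta M N : R) (n : nat)
    (halpha : -1 < alpha) (hbeta : -1 < beta)
    (hM : 0 <= M) (hN : 0 <= N) (hMN : 0 < M ^+ 2 + N ^+ 2) :
  [/\ alpha \isn't a Num.nat -> beta \isn't a Num.nat ->
        ode_order_infinite (gen_jacobi_coef alpha beta n M N),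
      forall kb : nat, 0 < M -> N = 0 -> beta = kb%:R ->
        ode_order_eq (gen_jacobi_coef alpha beta n M N) (2 * kb + 4)%N,
      forall ka : nat, M = 0 -> 0 < N -> alpha = ka%:R ->
        ode_order_eq (gen_jacobi_coef alpha beta n M N) (2 * ka + 4)%N
    & forall ka kb : nat, 0 < M -> 0 < N -> alpha = ka%:R -> beta = kb%:R ->
        ode_order_eq (gen_jacobi_coef alpha beta n M N)
          (2 * ka + 2 * kb + 6)%N].
Proof.
split.
- move=> aN bN; have [M0|M0] := eqVneq M 0.
    apply: (@ode_order_infinite_of_high R _ (-1) 3) => -[|i] // i3.
    rewrite gen_jacobi_coef_high // M0 !mul0r add0r addr0 b_pos_symm opprK.
    have N0 : N != 0 by apply: contraTneq hMN => ->; rewrite M0 expr0n addr0 ltxx.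
    apply: mulf_neq0 => //; apply: mulf_neq0; first by rewrite signr_eq0.
    exact: a_pos_one_neq0.
  apply: (@ode_order_infinite_of_high R _ 1 3) => -[|i] // i3.
  rewrite gen_jacobi_coef_high // b_pos_one c_coef_one !mulr0 !addr0.
  by apply: mulf_neq0 => //; apply: a_pos_one_neq0.
- move=> b M0 -> ->; apply: (@ode_order_eqP R _ 3) => [|i x bi].
    rewrite gen_jacobi_coef_high; last by lia.
    rewrite mulr0 !mul0r !addr0; apply: mulf_neq0; first by rewrite gt_eqF.
    exact: a_pos_nat_top_neq0.
  rewrite gen_jacobi_coef_high; last by lia.
  by rewrite a_pos_nat_eq0 // !(mulr0, mul0r) !addr0.
(* The witness is the mirror image of the point 3 used for [a_pos]. *)
- move=> a -> N0 ->; apply: (@ode_order_eqP R _ (-3)) => [|i x ai].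
    rewrite gen_jacobi_coef_high; last by lia.
    rewrite !mul0r add0r addr0; apply: mulf_neq0; first by rewrite gt_eqF.
    rewrite b_pos_symm opprK; apply: mulf_neq0; first by rewrite signr_eq0.
    exact: a_pos_nat_top_neq0.
  rewrite gen_jacobi_coef_high; last by lia.
  by rewrite b_pos_symm a_pos_nat_eq0 // !(mulr0, mul0r) !addr0.
(* As 2 a + 2 b + 6 exceeds both 2 a + 4 and 2 b + 4, only the term with M N survives from this
   index on. *)
- move=> a b M0 N0 aE bE; rewrite -mulnDr; subst alpha beta.
  apply: (@ode_order_eqP R _ 3) => [|i x abi]; rewrite gen_jacobi_coef_high;
    try lia; rewrite b_pos_symm !a_pos_nat_eq0 //; try lia.
    rewrite !mulr0 !add0r; apply: mulf_neq0; last exact: c_coef_nat_top_neq0.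
    by apply: mulf_neq0; rewrite gt_eqF.
  by rewrite c_coef_nat_eq0 // !mulr0 !addr0.
Qed.
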